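(* Let $n,m,L,U$ be integers with $n,m\ge1$ and $1\le L\le U\le n$, and let $(d^i_j)_{i\in[n],j\in[m]}$ be a binary matrix with $P_j=\frac1n\sum_{i\in[n]}d^i_j>0$ for every $j\in[m]$. Then problem (RSKL-Env) is a mixed-integer linear programming formulation of problem (RSKL). (Both problems are defined in the context.)
   Context: $[n]=\{1,\dots,n\}$. For nonempty $S\subseteq[n]$ let $P^S_j=\frac1{|S|}\sum_{i\in S}d^i_j$, and $P_j=P^{[n]}_j$. Let $\delta=\max\{m+1,n\}\cdot\log n$. (RSKL): minimize $I_{\mathrm{KL}}(S)=\sum_{j\in[m]}P_j\bigl|\log\frac{P_j}{P^S_j}\bigr|$ over $S\subseteq[n]$ with $L\le|S|\le U$, where, by convention, the $j$-th summand $P_j\bigl|\log\frac{P_j}{P_j^S}\bigr|$ equals $\delta$ whenever $P^S_j=0$. Subsets $S$ are identified with their indicator vectors $x\in\{0,1\}^n$. For $j\in[m]$ define $\phi_j(z)=\log(P_jz)$ for $z>0$ and $\phi_j(0)=2\log(P_j)-\log(2P_j)$; $\psi_j(z)=\log z$ for $z>0$ and $\psi_j(0)=\phi_j(U)-\frac{\delta}{P_j}$. Let $d_j=(d^1_j,\dots,d^n_j)$ and, for $x\in\{0,1\}^n$, $f_j(x)=\phi_j\bigl(\sum_{i\in[n]}x_i\bigr)$ and $g_j(x)=\psi_j(d_j^\top x)$. Let $S_j=\{i\in[n]: d^i_j=1\}$. The Lovász extension $f_{\mathtt L}:[0,1]^n\to\mathbb R$ of $f:\{0,1\}^n\to\mathbb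 R$ is defined as follows: write $x\in[0,1]^n$ as $x=\sum_{k=0}^n\lambda_k\chi^{T_k}$ with $\lambda_k\ge0$, $\sum_k\lambda_k=1$, $\emptyset=T_0\subseteq T_1\subseteq\dots\subseteq T_n=[n]$ with $|T_k|=k$ ($\chi^T$ is the indicator vector of $T$), and set $f_{\mathtt L}(x)=\sum_{k=0}^n\lambda_kf(\chi^{T_k})$. For the functions $f_j,g_j$ the constraint $s\ge f_{\mathtt L}(x)$ is represented by the finitely many linear inequalities $s\ge f^\pi(x)$, over all permutations $\pi$ of $[n]$, where $f^\pi(x)=\sum_{i=1}^n\bigl(f(\sum_{l=1}^ie_{\pi(l)})-f(\sum_{l=1}^{i-1}e_{\pi(l)})\bigr)x_{\pi(i)}+f(\mathbf 0)$ and $e_l$ is the $l$-th unit vector. For $x\in[0,1]^n$ put $$\mathrm{conc}(f_j)(x)=\min_{k\in[n]}\Bigl\{[\phi_j(k)-\phi_j(k-1)]\sum_{i\in[n]}x_i+k\phi_j(k-1)-(k-1)\phi_j(k)\Bigr\},$$ $$\mathrm{conc}(g_j)(x)=\min_{k\in[|S_j|]}\Bigl\{[\psi_j(k)-\psi_j(k-1)]\sum_{i\in S_j}x_i+k\psi_j(k-1)-(k-1)\psi_j(k)\Bigr\}$$ (the explicit expressions of the concave envelopes of $f_j,g_j$ over $[0,1]^n$). (RSKL-Env): minimize $\sum_{j\in[m]}P_j\mu_j$ over $x\in\{0,1\}^n$, $\mu,s,t\in\mathbb R^m$ subject to $L\le\sum_{i\in[n]}x_i\le U$ and, for all $j\in[m]$: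 $\mu_j\ge s_j-t_j$, $\mu_j\ge-s_j+t_j$, $(f_j)_{\mathtt L}(x)\le s_j\le\mathrm{conc}(f_j)(x)$, $(g_j)_{\mathtt L}(x)\le t_j\le\mathrm{conc}(g_j)(x)$. ''(RSKL-Env) is a mixed-integer linear programming formulation of (RSKL)'' means: apart from $x\in\{0,1\}^n$, the objective and constraints of (RSKL-Env) are linear (after writing, for each $j\in[m]$, the Lovász-extension constraints $s_j\ge(f_j)_{\mathtt L}(x)$ and $t_j\ge(g_j)_{\mathtt L}(x)$ as the finitely many linear inequalities $s_j\ge f_j^\pi(x)$ and $t_j\ge g_j^\pi(x)$ over all permutations $\pi$ of $[n]$, and the min-type constraints $s_j\le\mathrm{conc}(f_j)(x)$ and $t_j\le\mathrm{conc}(g_j)(x)$ as the finitely many linear inequalities $s_j\le[\phi_j(k)-\phi_j(k-1)]\sum_{i\in[n]}x_i+k\phi_j(k-1)-(k-1)\phi_j(k)$ for all $k\in[n]$ and $t_j\le[\psi_j(k)-\psi_j(k-1)]\sum_{i\in S_j}x_i+k\psi_j(k-1)-(k-1)\psi_j(k)$ for all $k\in[|S_j|]$); the two problems have the same optimal value; and $S$ is optimal for (RSKL) if and only if its indicator vector $x$ is the $x$-component of an optimal solution of (RSKL-Env). *)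

(* Defs.v *)
(* Built on MathComp and MathComp-Analysis; the reals are an arbitrary
   [R : realType], and [ln] is the natural logarithm. *)
From HB Require Import structures.
From Stdlib Require List.
From mathcomp Require Import all_boot all_order all_algebra perm.
From mathcomp Require Import all_classical all_reals all_analysis.

Set Implicit Arguments.
Unset Strict Implicit.
Unset Printing Implicit Defensive.

Import Order.TTheory GRing.Theory Num.Theory.

Local Open Scope classical_set_scope.
Local Open Scope ring_scope.

(* The index sets [n] and [m] are ['I_n] and ['I_m]; the binary matrix
   (d^i_j) is [d : 'M[bool]_(n, m)], with [d i j : bool] coerced to nat. *)

Section Optimization.
Variables (R : realType) (T : Type).

Definition optimal_solution (F : set T) (obj : T -> R) (t : T) : Prop :=
  F t /\ forall t', F t' -> obj t <= obj t'.

Definition optimal_value (F : set T) (obj : T -> R) : \bar R :=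
  ereal_inf [set (obj t)%:E | t in F].

End Optimization.

Section MILP.
Variables (R : realType) (V : lmodType R).

Definition affine (h : V -> R) : Prop :=
  exists (l : V -> R) (c : R), scalar l /\ forall v, h v = l v + c.

(* A pair [c] of functions stands for the constraint [c.1 v <= c.2 v]. *)
Definition satisfies (sys : seq ((V -> R) * (V -> R))) (v : V) : Prop :=
  List.Forall (fun c => c.1 v <= c.2 v) sys.

(* [obj] is linear, and [F] consists of the points that meet the integrality
   requirement [bin] and the finite system [sys] of linear inequalities. *)
Definition is_milp (bin F : set V) (obj : V -> R)
    (sys : seq ((V -> R) * (V -> R))) : Prop :=
  [/\ scalar obj,
      List.Forall (fun c => affine c.1 /\ affine c.2) sys &
      F = [set v | bin v /\ satisfies sys v]].

End MILP.

Section Lovasz.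
Variables (R : realType) (n : nat).

Definition chi (T : {set 'I_n}) : 'rV[R]_n := \row_i (i \in T)%:R.

Definition unit_vec (l : 'I_n) : 'rV[R]_n := delta_mx 0 l.

Definition binary (x : 'rV[R]_n) : Prop := forall i, x 0 i = 0 \/ x 0 i = 1.

Definition in_unit_cube (x : 'rV[R]_n) : Prop := forall i, 0 <= x 0 i <= 1.

(* The cardinality condition forces T_0 = set0 and T_n = [set: 'I_n]. *)
Definition chain_decomposition (x : 'rV[R]_n)
    (T : 'I_n.+1 -> {set 'I_n}) (lam : 'I_n.+1 -> R) : Prop :=
  [/\ forall k, #|T k| = k,
      forall k l : 'I_n.+1, (k <= l)%N -> T k \subset T l,
      forall k, 0 <= lam k,
      \sum_k lam k = 1 &
      x = \sum_k lam k *: chi (T k)].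

(* A function on {0,1}^n is given as a function on 'rV[R]_n, and only its
   values at 0/1 vectors are used.  The value \sum_k lam_k f(chi^{T_k}) exists
   and is the same for all chain decompositions of a point of [0,1]^n; [xget]
   selects it (the default 0 is only used outside [0,1]^n). *)
Definition lovasz (f : 'rV[R]_n -> R) (x : 'rV[R]_n) : R :=
  xget 0 [set v | exists T lam, chain_decomposition x T lam /\
                                v = \sum_k lam k * f (chi (T k))].

Definition perm_form (f : 'rV[R]_n -> R) (p : {perm 'I_n}) (x : 'rV[R]_n) : R :=
  \sum_(i < n) (f (\sum_(l < n | (l <= i)%N) unit_vec (p l))
                - f (\sum_(l < n | (l < i)%N) unit_vec (p l))) * x 0 (p i)
  + f 0.

End Lovasz.

Section Concave.
Variable R : realType.

Definition conc_piece (h : R -> R) (k : nat) (z : R) : R :=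
  (h k%:R - h k.-1%:R) * z + k%:R * h k.-1%:R - k.-1%:R * h k%:R.

(* min_{k in {1, ..., N}} F k for N >= 1; the starting value F 1 is itself one
   of the terms, so it does not affect the minimum. *)
Definition min_upto (N : nat) (F : nat -> R) : R :=
  \big[Num.min/F 1%N]_(1 <= k < N.+1) F k.

End Concave.

Section RSKL.
Variables (R : realType) (n m : nat) (d : 'M[bool]_(n, m)) (L U : nat).

Definition PS (S : {set 'I_n}) (j : 'I_m) : R :=
  #|S|%:R^-1 * \sum_(i in S) (d i j)%:R.

Definition P_ (j : 'I_m) : R := PS [set: 'I_n] j.

Definition delta : R := (maxn m.+1 n)%:R * ln n%:R.

Definition rskl_feasible : set {set 'I_n} := [set S | (L <= #|S| <= U)%N].

Definition rskl_obj (S : {set 'I_n}) : R :=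
  \sum_j (if PS S j == 0 then delta else P_ j * `|ln (P_ j / PS S j)|).

(* [phi] and [psi] are only used at natural numbers. *)
Definition phi (j : 'I_m) (z : R) : R :=
  if 0 < z then ln (P_ j * z) else 2 * ln (P_ j) - ln (2 * P_ j).

Definition psi (j : 'I_m) (z : R) : R :=
  if 0 < z then ln z else phi j U%:R - delta / P_ j.

Definition ones (j : 'I_m) : {set 'I_n} := [set i | d i j].

Definition f_ (j : 'I_m) (x : 'rV[R]_n) : R := phi j (\sum_i x 0 i).

Definition g_ (j : 'I_m) (x : 'rV[R]_n) : R :=
  psi j (\sum_i (d i j)%:R * x 0 i).

Definition conc_f (j : 'I_m) (x : 'rV[R]_n) : R :=
  min_upto n (fun k => conc_piece (phi j) k (\sum_i x 0 i)).

Definition conc_g (j : 'I_m) (x : 'rV[R]_n) : R :=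
  min_upto #|ones j| (fun k => conc_piece (psi j) k (\sum_(i in ones j) x 0 i)).

(* Variables (x, mu, s, t) of the envelope formulation. *)
Definition env_var : lmodType R :=
  ('rV[R]_n * 'rV[R]_m * 'rV[R]_m * 'rV[R]_m)%type.

Definition xpart (v : env_var) : 'rV[R]_n := v.1.1.1.
Definition mupart (v : env_var) : 'rV[R]_m := v.1.1.2.
Definition spart (v : env_var) : 'rV[R]_m := v.1.2.
Definition tpart (v : env_var) : 'rV[R]_m := v.2.

Definition env_feasible : set env_var := [set v |
  [/\ binary (xpart v),
      L%:R <= \sum_i xpart v 0 i <= U%:R &
      forall j : 'I_m,
        [/\ mupart v 0 j >= spart v 0 j - tpart v 0 j,
            mupart v 0 j >= - spart v 0 j + tpart v 0 j,
            lovasz (f_ j) (xpart v) <= spart v 0 j <= conc_f j (xpart v) &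
            lovasz (g_ j) (xpart v) <= tpart v 0 j <= conc_g j (xpart v)]]].

Definition env_obj (v : env_var) : R := \sum_j P_ j * mupart v 0 j.

Definition env_binary : set env_var := [set v | binary (xpart v)].

(* The constraints other than integrality, with the Lovasz-extension and
   min-type constraints replaced by their finitely many linear inequalities. *)
Definition env_system : seq ((env_var -> R) * (env_var -> R)) :=
  [:: (fun=> L%:R, fun v => \sum_i xpart v 0 i);
      (fun v => \sum_i xpart v 0 i, fun=> U%:R)]
  ++ flatten [seq
       [:: (fun v => spart v 0 j - tpart v 0 j, fun v => mupart v 0 j);
           (fun v => - spart v 0 j + tpart v 0 j, fun v => mupart v 0 j)]
       ++ [seq (fun v => perm_form (f_ j) p (xpart v), fun v => spart v 0 j)
             | p : {perm 'I_n}]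
       ++ [seq (fun v => perm_form (g_ j) p (xpart v), fun v => tpart v 0 j)
             | p : {perm 'I_n}]
       ++ [seq (fun v => spart v 0 j,
                fun v => conc_piece (phi j) k (\sum_i xpart v 0 i))
             | k <- iota 1 n]
       ++ [seq (fun v => tpart v 0 j,
                fun v => conc_piece (psi j) k (\sum_(i in ones j) xpart v 0 i))
             | k <- iota 1 #|ones j|]
     | j : 'I_m].

End RSKL.

(* [R] is explicit where it cannot be read off the other arguments. *)
Arguments PS R {n m} d S j.
Arguments P_ R {n m} d j.
Arguments rskl_obj R {n m} d S.
Arguments phi {R n m} d j z.
Arguments psi {R n m} d U j z.
Arguments f_ {R n m} d j x.
Arguments g_ {R n m} d U j x.
Arguments conc_f {R n m} d j x.
Arguments conc_g {R n m} d U j x.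
Arguments env_feasible R {n m} d L U _.
Arguments env_obj R {n m} d v.
Arguments env_binary R n m _ : clear implicits.
Arguments env_system R {n m} d L U.

(* Main.v *)
Require Import Defs.
From Stdlib Require List.
From mathcomp Require Import all_boot all_order all_algebra perm.
From mathcomp Require Import all_classical all_reals all_analysis.
From mathcomp Require Import lra fintype finset.

Import Order.TTheory GRing.Theory Num.Theory.

Local Open Scope ring_scope.

(** The theorem rests on the concavity of phi on 0, 1, 2, ... and of psi on
    0, ..., n ([phi_concave], [psi_concave]).  At a 0/1 vector, [f_ d j] and
    [g_ d U j] evaluate a concave sequence at the number of selected elements
    of a fixed set, hence they are submodular ([submodular_card]), and two
    things follow.

    First, the Lovasz extension of a submodular function is the maximum of its
    permutation forms on the cube ([lovasz_le]), so that all the constraints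
    of the envelope problem are finite systems of linear inequalities
    ([env_is_milp]).

    Secondly, at the indicator vector of a set [S] the Lovasz extension and
    the minimum of chords both equal the function ([lovasz_chi],
    [le_min_conc_piece_nat]).  The constraints therefore force s and t to be
    the function values, the best mu is the absolute difference, and the
    envelope problem amounts to the minimization of [env_cost] over feasible
    sets.

    It remains to compare [env_cost] with [rskl_obj].  The terms agree when
    [S] meets [ones d j].  Otherwise the term of [rskl_obj] is delta, while
    that of [env_cost] is delta - P_j ln (U / #|S|): the two objectives differ
    on the sets that leave some [j] uncovered and have fewer than [U] elements
    ([env_cost_le_rskl_obj], [env_cost_eq_rskl_obj]).  Such a set never
    minimizes [env_cost]: adding an element that covers [j] saves more than
    (m - 1) ln n in the [j]-th term, because delta is at least (m + 1) ln n,
    and costs at most ln n in each of the other terms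
    ([env_cost_not_minimal]).  So [env_cost] is below [rskl_obj] everywhere
    and equal to it at the minimizers of [env_cost], which gives the same
    minimum and the same minimizers ([optimal_rskl_env_cost]). *)

(** * Concave sequences and their chords *)

Definition concave_upto (R : realType) (N : nat) (h : nat -> R) : Prop :=
  forall k, (k.+2 <= N)%N -> h k.+2 - h k.+1 <= h k.+1 - h k.

Lemma concave_incr_le (R : realType) (N : nat) (h : nat -> R) (k l : nat) :
  concave_upto R N h -> (k <= l < N)%N -> h l.+1 - h l <= h k.+1 - h k.
Proof.
move=> hc; elim: l => [|l IHl] /andP[kl lN].
  by move: kl; rewrite leqn0 => /eqP ->.
move: kl; rewrite leq_eqVlt => /orP[/eqP -> //|kl].
apply: (le_trans (hc l lN)); apply: IHl.
by rewrite -ltnS kl /= ltnW.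
Qed.

(** To the right of [k] the increments are at most the slope of this chord, to
    the left of [k] they are at least that slope. *)
Lemma concave_le_chord (R : realType) (N : nat) (h : nat -> R) (k z : nat) :
  concave_upto R N h -> (k < N)%N -> (z <= N)%N ->
  h z <= h k + (h k.+1 - h k) * (z%:R - k%:R).
Proof.
move=> hc kN zN; have [kz|/ltnW zk] := leqP k z.
  rewrite -(subnKC kz); move: (z - k)%N (subnKC kz) => e; elim: e z {kz} zN.
    by move=> z _ _; rewrite addn0 subrr mulr0 addr0.
  move=> e IHe z zN zE; rewrite -zE addnS in zN *.
  have := IHe _ (ltnW zN) erefl.
  have := concave_incr_le R N h k (k + e) hc; rewrite leq_addr zN => /(_ isT).
  by rewrite -natr1; lra.
(* As the base of the chord moves right, the slope can only decrease. *)
move: kN; rewrite -(subnKC zk); elim: (k - z)%N => [|e IHe] zeN.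
  by rewrite addn0 subrr mulr0 addr0.
rewrite addnS in zeN *.
have hk := hc (z + e)%N zeN.
have := IHe (ltnW zeN).
rewrite -natr1.
have : (z%:R : R) <= (z + e)%:R by rewrite ler_nat leq_addr.
nra.
Qed.

Lemma le_min_upto (R : realType) (N : nat) (F : nat -> R) (a : R) :
  (1 <= N)%N ->
  a <= min_upto N F <-> (forall k, (1 <= k <= N)%N -> a <= F k).
Proof.
move=> N1; split=> [aF k kN|aF].
  by apply: (le_trans aF); apply: ge_bigmin_seq; rewrite ?mem_index_iota.
rewrite /min_upto big_seq; apply: le_bigmin; first by apply: aF; rewrite N1.
by move=> k; rewrite mem_index_iota ltnS => /aF.
Qed.

Lemma conc_piece_nat (R : realType) (N : nat) (h : R -> R) (k z : nat) :
  concave_upto R N (fun i => h i%:R) -> (1 <= k <= N)%N -> (z <= N)%N ->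
  h z%:R <= conc_piece h k z%:R.
Proof.
case: k => // k hc kN zN.
have /(_ kN zN) := concave_le_chord R N _ k z hc.
rewrite /conc_piece /= -natr1; lra.
Qed.

(** The chord ending at the abscissa itself, or the first chord at the
    abscissa 0, is the tight one. *)
Lemma conc_piece_nat_tight (R : realType) (h : R -> R) (z : nat) :
  conc_piece h (maxn 1 z) z%:R = h z%:R.
Proof.
rewrite /conc_piece; case: z => [|z] /=; first by rewrite maxn0 /=; lra.
by rewrite (maxn_idPr _) //= -natr1; lra.
Qed.

Lemma le_min_conc_piece_nat (R : realType) (N : nat) (h : R -> R) (z : nat)
    (a : R) :
  concave_upto R N (fun i => h i%:R) -> (1 <= N)%N -> (z <= N)%N ->
  a <= min_upto N (fun k => conc_piece h k z%:R) <-> a <= h z%:R.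
Proof.
move=> hc N1 zN; rewrite le_min_upto //; split=> [ap|az k kN].
  by rewrite -conc_piece_nat_tight; apply: ap; rewrite leq_max geq_max N1.
exact: le_trans az (conc_piece_nat _ _ _ _ _ hc kN zN).
Qed.

(** * Lovasz extensions of submodular functions *)

(** The diminishing-returns form of submodularity. *)
Definition submodular (R : realType) (n : nat) (f : 'rV[R]_n -> R) : Prop :=
  forall (A B : {set 'I_n}) (a : 'I_n), B \subset A -> a \notin A ->
    f (chi R (a |: A)) - f (chi R A) <= f (chi R (a |: B)) - f (chi R B).

(** Adding an element outside [S] changes nothing, and adding an element of [S]
    yields an increment of [h], which decreases with the size of the set. *)
Lemma submodular_card (R : realType) (n : nat) (f : 'rV[R]_n -> R)
    (S : {set 'I_n}) (h : nat -> R) :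
  concave_upto R #|S| h -> (forall T, f (chi R T) = h #|T :&: S|) ->
  submodular R n f.
Proof.
move=> hc hf A B a sBA aA; rewrite !hf !setIUl.
have aB : a \notin B by apply: contra aA; apply: (subsetP sBA).
have [aS|aS] := boolP (a \in S); last first.
  have -> : [set a] :&: S = set0.
    by apply/setP => i; rewrite !inE; case: eqP => // ->; rewrite (negPf aS).
  by rewrite !set0U !subrr.
have -> : [set a] :&: S = [set a].
  by apply/setP => i; rewrite !inE; case: eqP => // ->; rewrite aS.
rewrite !cardsU1 !inE (negPf aA) (negPf aB) /= !add1n.
apply: concave_incr_le hc _; rewrite subset_leq_card ?setSI //=.
by rewrite proper_card // properE subsetIr; apply/subsetPn; exists a;
  rewrite // inE (negPf aA).
Qed.

Definition prefix_set (n : nat) (p : {perm 'I_n}) (k : nat) : {set 'I_n} :=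
  [set p l | l : 'I_n & (l < k)%N].

Lemma mem_prefix_set (n : nat) (p : {perm 'I_n}) (k : nat) (l : 'I_n) :
  (p l \in prefix_set n p k) = (l < k)%N.
Proof. by rewrite mem_imset ?inE //; apply: perm_inj. Qed.

Lemma prefix_setS (n : nat) (p : {perm 'I_n}) (i : 'I_n) :
  prefix_set n p i.+1 = p i |: prefix_set n p i.
Proof.
apply/setP => a; rewrite -(permKV p a) !inE !mem_prefix_set ltnS leq_eqVlt.
by rewrite (inj_eq perm_inj) -val_eqE.
Qed.

Lemma card_prefix_set (n : nat) (p : {perm 'I_n}) (k : nat) :
  (k <= n)%N -> #|prefix_set n p k| = k.
Proof.
move=> kn; rewrite card_imset; last exact: perm_inj.
rewrite -sum1_card (eq_bigl (fun l : 'I_n => (l < k)%N)); last first.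
  by move=> l; rewrite inE.
by rewrite (big_ord_narrow kn) /= sum1_card card_ord.
Qed.

Lemma chi_prefix_set (R : realType) (n : nat) (p : {perm 'I_n}) (k : nat) :
  \sum_(l < n | (l < k)%N) unit_vec R (p l) = chi R (prefix_set n p k).
Proof.
apply/rowP => a; rewrite summxE mxE -(permKV p a) mem_prefix_set.
under eq_bigr do rewrite mxE eqxx /= (inj_eq perm_inj) eq_sym.
rewrite big_mkcond /= (bigD1 (p^-1 a)%g) //= eqxx big1 ?addr0.
  by case: ifP.
by move=> l /negPf ->; rewrite if_same.
Qed.

Lemma chi_set0 (R : realType) (n : nat) : chi R (set0 : {set 'I_n}) = 0.
Proof. by apply/rowP => a; rewrite !mxE inE. Qed.

Lemma prefix_set0 (n : nat) (p : {perm 'I_n}) : prefix_set n p 0 = set0.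
Proof.
by apply/setP => a; rewrite -(permKV p a) mem_prefix_set inE.
Qed.

Lemma prefix_setT (n : nat) (p : {perm 'I_n}) : prefix_set n p n = [set: 'I_n].
Proof.
by apply/setP => a; rewrite -(permKV p a) mem_prefix_set inE ltn_ord.
Qed.

Lemma perm_formE (R : realType) (n : nat) (f : 'rV[R]_n -> R) p x :
  perm_form f p x =
  \sum_(i < n) (f (chi R (prefix_set n p i.+1))
                - f (chi R (prefix_set n p i))) * x 0 (p i) + f (chi R set0).
Proof.
by rewrite /perm_form chi_set0; congr (_ + _); apply: eq_bigr => i _;
  rewrite -!chi_prefix_set.
Qed.

Lemma telescope_prefix_setI (R : realType) (n : nat) (F : {set 'I_n} -> R)
    (p : {perm 'I_n}) (T : {set 'I_n}) :
  F T = \sum_(i < n) (F (prefix_set n p i.+1 :&: T)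
                      - F (prefix_set n p i :&: T)) + F set0.
Proof.
rewrite -(big_mkord xpredT (fun i => F (prefix_set n p i.+1 :&: T)
                                     - F (prefix_set n p i :&: T))).
rewrite (telescope_sumr (fun i => F (prefix_set n p i :&: T))) //.
by rewrite prefix_setT prefix_set0 setTI set0I subrK.
Qed.

Lemma prefix_setSI_notin (n : nat) (p : {perm 'I_n}) (T : {set 'I_n})
    (i : 'I_n) :
  p i \notin T -> prefix_set n p i.+1 :&: T = prefix_set n p i :&: T.
Proof.
move=> iT; rewrite prefix_setS setIUl; apply/setP => a; rewrite !inE.
by case: eqP => [->|]; rewrite //= (negPf iT) andbF.
Qed.

(** By submodularity the increment of [f] at [p i] along the prefixes of [p]
    is at most the increment along the traces of these prefixes on [T], and
    the latter increments telescope to [f T]. *)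
Lemma perm_form_chi_le (R : realType) (n : nat) (f : 'rV[R]_n -> R) p T :
  submodular R n f -> perm_form f p (chi R T) <= f (chi R T).
Proof.
move=> fsub; rewrite perm_formE.
rewrite [leRHS](telescope_prefix_setI R n (fun A => f (chi R A)) p T).
rewrite lerD2r; apply: ler_sum => i _; rewrite mxE.
have [iT|iT] := boolP (p i \in T); last first.
  by rewrite mulr0 prefix_setSI_notin // subrr.
rewrite mulr1 prefix_setS setIUl.
have -> : [set p i] :&: T = [set p i].
  by apply/setP => a; rewrite !inE; case: eqP => // ->; rewrite iT.
apply: fsub; first exact: subsetIl.
by rewrite mem_prefix_set ltnn.
Qed.

(** The previous bound is attained along [p], where the traces of prefixes on
    [T] are prefixes again. *)
Lemma perm_form_chi_prefix (R : realType) (n : nat) (f : 'rV[R]_n -> R) p k :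
  perm_form f p (chi R (prefix_set n p k)) = f (chi R (prefix_set n p k)).
Proof.
rewrite perm_formE.
rewrite [RHS](telescope_prefix_setI R n (fun A => f (chi R A)) p).
congr (_ + _); apply: eq_bigr => i _; rewrite mxE mem_prefix_set.
have sub (j l : nat) : (j <= l)%N ->
    prefix_set n p j :&: prefix_set n p l = prefix_set n p j.
  move=> jl; apply/setIidPl/subsetP => a.
  by rewrite -(permKV p a) !mem_prefix_set => /leq_trans; apply.
have [ik|ki] := ltnP i k; first by rewrite mulr1 !sub // ltnW.
by rewrite mulr0 prefix_setSI_notin ?subrr // mem_prefix_set -leqNgt.
Qed.

Lemma perm_form_convex_comb (R : realType) (n : nat) (f : 'rV[R]_n -> R) p
    (I : finType) (lam : I -> R) (y : I -> 'rV[R]_n) :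
  \sum_k lam k = 1 ->
  perm_form f p (\sum_k lam k *: y k) = \sum_k lam k * perm_form f p (y k).
Proof.
move=> lam1; rewrite /perm_form.
under [RHS]eq_bigr do rewrite mulrDr.
rewrite big_split /= -mulr_suml lam1 mul1r; congr (_ + _).
under [RHS]eq_bigr do rewrite mulr_sumr.
rewrite exchange_big /=; apply: eq_bigr => i _.
rewrite summxE mulr_sumr; apply: eq_bigr => k _.
by rewrite mxE mulrCA.
Qed.

(** A maximal chain adds one element at a time; the order in which the
    elements enter is the permutation. *)
Lemma chain_prefix_set (n : nat) (T : 'I_n.+1 -> {set 'I_n}) :
  (forall k, #|T k| = k) ->
  (forall k l : 'I_n.+1, (k <= l)%N -> T k \subset T l) ->
  exists p : {perm 'I_n}, forall k, T k = prefix_set n p k.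
Proof.
move=> cT sT.
have /fin_all_exists[q qT] (i : 'I_n) : exists a,
    a \in T (lift ord0 i) :\: T (widen_ord (leqnSn n) i).
  apply/set0Pn; rewrite -card_gt0 cardsD.
  rewrite (setIidPr (sT _ _ _)) ?cT /= /bump //= add1n ?subSnn //.
have qinj : injective q.
  suff lt_neq (i j : 'I_n) : (i < j)%N -> q i != q j.
    move=> i j qij; apply: ord_inj.
    by case: (ltngtP i j) => // /lt_neq; rewrite qij eqxx.
  move=> ij; apply: contraTneq (qT j) => <-; rewrite inE negb_and negbK.
  apply/orP; left.
  move: (qT i); rewrite inE => /andP[_]; apply: (subsetP (sT _ _ _)).
  by rewrite /= /bump /= add1n.
exists (perm qinj) => k; apply/esym/eqP; rewrite eqEcard.
rewrite cT card_prefix_set ?leqnn ?andbT; last by rewrite -ltnS.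
apply/subsetP => _ /imsetP[l lk ->]; rewrite inE in lk; rewrite permE.
move: (qT l); rewrite inE => /andP[_]; apply: (subsetP (sT _ _ _)).
by rewrite /= /bump /= add1n.
Qed.

(** Sorting the coordinates decreasingly gives the chain, and the weights are
    the gaps between consecutive values of 1, the sorted coordinates, 0. *)
Lemma chain_decomposition_exists (R : realType) (n : nat) (x : 'rV[R]_n) :
  in_unit_cube x -> exists T lam, chain_decomposition x T lam.
Proof.
move=> x01.
pose s := sort (fun i j : 'I_n => x 0 j <= x 0 i) (enum 'I_n).
have ss : size s = n by rewrite size_sort size_enum_ord.
have su : uniq s by rewrite sort_uniq enum_uniq.
have s_sorted : sorted (fun i j : 'I_n => x 0 j <= x 0 i) s.
  by apply: sort_sorted => i j; apply: le_total.
have pinj : injective (fun i : 'I_n => nth i s i).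
  move=> i j; rewrite (set_nth_default i) ?ss // => /eqP.
  by rewrite nth_uniq ?ss // => /eqP/ord_inj.
pose p := perm pinj.
pose y k := nth 0 (1 :: [seq x 0 i | i <- s]) k.
have y0 : y 0%N = 1 by [].
have yn : y n.+1 = 0 by rewrite /y /= nth_default // size_map ss.
have yS (i : 'I_n) : y i.+1 = x 0 (p i).
  by rewrite /y /= (nth_map i) ?ss // permE.
have y_ge0 k : 0 <= y k.
  case: k => [|k]; first by rewrite y0.
  have [kn|nk] := ltnP k n.
    by rewrite (yS (Ordinal kn)); case/andP: (x01 (p (Ordinal kn))).
  by rewrite /y nth_default //= size_map ss.
have ydec k : (k < n.+1)%N -> y k.+1 <= y k.
  rewrite ltnS leq_eqVlt => /orP[/eqP -> | kn]; first by rewrite yn.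
  rewrite (yS (Ordinal kn)); case: k kn => [|k] kn.
    by rewrite y0; case/andP: (x01 (p (Ordinal kn))).
  rewrite (yS (Ordinal (ltnW kn))) !permE.
  rewrite (set_nth_default (Ordinal kn)) ?ss //=; last exact: ltnW.
  have ge_trans : transitive (fun i j : 'I_n => x 0 j <= x 0 i).
    by move=> i j l ji il; apply: le_trans il ji.
  have ge_refl : reflexive (fun i j : 'I_n => x 0 j <= x 0 i).
    by move=> i /=; exact: lexx.
  by apply: (sorted_leq_nth ge_trans ge_refl _ s_sorted);
    rewrite ?inE ?ss // ltnW.
have gaps j : (j <= n.+1)%N -> \sum_(j <= k < n.+1) (y k - y k.+1) = y j.
  move=> jn; under eq_bigr do rewrite -opprB.
  by rewrite sumrN telescope_sumr // yn sub0r opprK.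
exists (fun k => prefix_set n p k), (fun k => y k - y k.+1); split.
- by move=> k; rewrite card_prefix_set // -ltnS.
- move=> k l kl; apply/subsetP => a.
  by rewrite -(permKV p a) !mem_prefix_set => /leq_trans; apply.
- by move=> k; rewrite subr_ge0 ydec.
- by rewrite -(big_mkord xpredT (fun k => y k - y k.+1)) gaps.
- apply/rowP => a; rewrite summxE -(permKV p a); set l := (p^-1 a)%g.
  rewrite -(yS l) -gaps; last first.
    by rewrite ltnS ltnW.
  rewrite (big_geq_mkord _ _ xpredT).
  rewrite big_mkcond; apply: eq_bigr => k _ /=.
  by rewrite !mxE mem_prefix_set; case: ltnP; rewrite ?mulr1 ?mulr0.
Qed.

(** The value of a chain decomposition of [x] is a permutation form at [x] (for
    the order in which the chain grows), and it is at least every permutation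
    form, because these are affine and lie below [f] at 0/1 vectors.  Hence all
    chain decompositions of [x] give the same value, the maximum of these
    forms. *)
Lemma lovasz_le (R : realType) (n : nat) (f : 'rV[R]_n -> R) (x : 'rV[R]_n)
    (a : R) :
  submodular R n f -> in_unit_cube x ->
  lovasz f x <= a <-> (forall p : {perm 'I_n}, perm_form f p x <= a).
Proof.
move=> fsub x01.
have value_ge T lam p : chain_decomposition x T lam ->
    perm_form f p x <= \sum_k lam k * f (chi R (T k)).
  case=> _ _ lam0 lam1 ->; rewrite perm_form_convex_comb //.
  by apply: ler_sum => k _; rewrite ler_wpM2l // perm_form_chi_le.
have value_attained T lam : chain_decomposition x T lam ->
    exists p, perm_form f p x = \sum_k lam k * f (chi R (T k)).
  case=> cT sT _ lam1 ->; have [p pT] := chain_prefix_set n T cT sT.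
  exists p; rewrite perm_form_convex_comb //.
  by apply: eq_bigr => k _; rewrite pT perm_form_chi_prefix.
have [T [lam Tlam]] := chain_decomposition_exists R n x x01.
have -> : lovasz f x = \sum_k lam k * f (chi R (T k)).
  apply: xget_unique; first by exists T, lam.
  move=> _ [T' [lam' [Tlam' ->]]]; apply/eqP; rewrite eq_le; apply/andP; split.
    by have [p <-] := value_attained _ _ Tlam'; apply: value_ge.
  by have [p <-] := value_attained _ _ Tlam; apply: value_ge.
split=> [fa p|fa]; first by apply: le_trans fa; apply: value_ge.
by have [p <-] := value_attained _ _ Tlam.
Qed.

(** A vertex of the cube is a convex combination of vertices only
    trivially. *)
Lemma lovasz_chi (R : realType) (n : nat) (f : 'rV[R]_n -> R) (S : {set 'I_n}) :
  lovasz f (chi R S) = f (chi R S).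
Proof.
have trivial_value T lam : chain_decomposition (chi R S) T lam ->
    \sum_k lam k * f (chi R (T k)) = f (chi R S).
  case=> _ _ lam0 lam1 /rowP SE.
  rewrite -[RHS]mul1r -lam1 mulr_suml; apply: eq_bigr => k _.
  have [->|lamk] := eqVneq (lam k) 0; first by rewrite !mul0r.
  suff -> : T k = S by [].
  apply/setP => i; move: (SE i); rewrite summxE mxE.
  under eq_bigr do rewrite !mxE.
  have [_|_] := boolP (i \in S) => [sE|sE]; last first.
    have := psumr_eq0P (fun k _ => mulr_ge0 (lam0 k) (ler0n R (i \in T k)))
      (esym sE) (i:=k) isT.
    by move/eqP; rewrite mulf_eq0 (negPf lamk) pnatr_eq0 eqb0 => /negPf.
  (* The weights sum to 1, which is also the weight of the sets containing i. *)
  have cE : \sum_k lam k * (i \notin T k)%:R = 0.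
    apply: (@addIr R (\sum_k lam k * (i \in T k)%:R)).
    rewrite -big_split /= -sE add0r mulr1n -[RHS]lam1; apply: eq_bigr => l _.
    by case: (i \in T l); rewrite ?mulr0 ?mulr1 ?addr0 ?add0r.
  have := psumr_eq0P (fun k _ => mulr_ge0 (lam0 k) (ler0n R (i \notin T k)))
    cE (i:=k) isT.
  by move/eqP; rewrite mulf_eq0 (negPf lamk) pnatr_eq0 eqb0 negbK.
apply: xget_unique; last by move=> _ [T [lam [Tlam ->]]]; apply: trivial_value.
have [|T [lam Tlam]] := chain_decomposition_exists R n (chi R S).
  by move=> i; rewrite mxE; case: (i \in S); rewrite ?lexx ?ler01.
by exists T, lam; split=> //; rewrite trivial_value.
Qed.

(** * The functions phi and psi *)

Lemma ln_natD1_concave (R : realType) (a : R) :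
  0 < a -> ln (a + 1 + 1) - ln (a + 1) <= ln (a + 1) - ln a.
Proof.
move=> a0; suff : ln ((a + 1 + 1) * a) <= ln ((a + 1) * (a + 1)).
  by rewrite !lnM ?posrE ?addr_gt0 ?ltr01 //; lra.
by rewrite ler_ln ?posrE ?mulr_gt0 ?addr_gt0 ?ltr01 //; nra.
Qed.

Lemma sum_mem_nat (R : realType) (T : finType) (A B : {set T}) :
  \sum_(i in A) (i \in B)%:R = #|A :&: B|%:R :> R.
Proof.
rewrite -sum1_card natr_sum [LHS]big_mkcond [RHS]big_mkcond.
by apply: eq_bigr => i _; rewrite inE; case: (i \in A); case: (i \in B).
Qed.

Lemma PSE (R : realType) (n m : nat) (d : 'M[bool]_(n, m)) (S : {set 'I_n})
    (j : 'I_m) :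
  PS R d S j = #|S|%:R^-1 * #|S :&: ones d j|%:R.
Proof.
rewrite /PS -sum_mem_nat; congr (_ * _); apply: eq_bigr => i _.
by rewrite inE.
Qed.

Lemma P_E (R : realType) (n m : nat) (d : 'M[bool]_(n, m)) (j : 'I_m) :
  P_ R d j = n%:R^-1 * #|ones d j|%:R.
Proof. by rewrite /P_ PSE setTI cardsT card_ord. Qed.

Lemma card_ones_gt0 (R : realType) (n m : nat) (d : 'M[bool]_(n, m))
    (j : 'I_m) : 0 < P_ R d j -> (1 <= #|ones d j|)%N.
Proof. by rewrite lt0n P_E; case: eqP => // ->; rewrite mulr0 ltxx. Qed.

Lemma card_ones_le (n m : nat) (d : 'M[bool]_(n, m)) (j : 'I_m) :
  (#|ones d j| <= n)%N.
Proof. by rewrite -[leqRHS]card_ord max_card. Qed.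

Lemma P_le1 (R : realType) (n m : nat) (d : 'M[bool]_(n, m)) (j : 'I_m) :
  (1 <= n)%N -> P_ R d j <= 1.
Proof.
move=> n1; rewrite P_E mulrC ler_pdivrMr ?ltr0n // mul1r ler_nat.
exact: card_ones_le.
Qed.

Lemma ln_P_ge (R : realType) (n m : nat) (d : 'M[bool]_(n, m)) (j : 'I_m) :
  (1 <= n)%N -> 0 < P_ R d j -> - ln n%:R <= ln (P_ R d j).
Proof.
move=> n1 P0; have c1 := card_ones_gt0 _ _ _ _ _ P0.
rewrite P_E lnM ?posrE ?invr_gt0 ?ltr0n // lnV ?posrE ?ltr0n // lerDl.
by rewrite ln_ge0 // ler1n.
Qed.

Lemma ler_ln_nat (R : realType) (k l : nat) :
  (1 <= k <= l)%N -> ln k%:R <= ln l%:R :> R.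
Proof.
move=> /andP[k1 kl]; rewrite ler_ln ?posrE ?ltr0n ?ler_nat //.
exact: leq_trans kl.
Qed.

Lemma ln_nat_ge0 (R : realType) (n : nat) : 0 <= ln n%:R :> R.
Proof. by case: n => [|n]; [rewrite ln0 | rewrite ln_ge0 // ler1n]. Qed.

Lemma delta_ge (R : realType) (n m : nat) :
  m.+1%:R * ln n%:R <= delta R n m.
Proof. by rewrite ler_wpM2r ?ln_nat_ge0 // ler_nat leq_maxl. Qed.

Lemma phi_natE (R : realType) (n m : nat) (d : 'M[bool]_(n, m)) (j : 'I_m)
    (k : nat) :
  0 < P_ R d j -> (1 <= k)%N -> phi d j k%:R = ln (P_ R d j) + ln k%:R.
Proof. by move=> P0 k1; rewrite /phi ltr0n k1 lnM ?posrE ?ltr0n. Qed.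

Lemma psi_natE (R : realType) (n m U : nat) (d : 'M[bool]_(n, m)) (j : 'I_m)
    (k : nat) :
  (1 <= k)%N -> psi d U j k%:R = ln k%:R :> R.
Proof. by move=> k1; rewrite /psi ltr0n k1. Qed.

Lemma psi0E (R : realType) (n m U : nat) (d : 'M[bool]_(n, m)) (j : 'I_m) :
  0 < P_ R d j -> (1 <= U)%N ->
  psi d U j 0%:R = ln (P_ R d j) + ln U%:R - delta R n m / P_ R d j.
Proof. by move=> P0 U1; rewrite /psi ltxx phi_natE. Qed.

(** The value at 0 is the linear extrapolation of the values at 1 and 2. *)
Lemma phi_concave (R : realType) (n m : nat) (d : 'M[bool]_(n, m)) (j : 'I_m)
    (N : nat) :
  0 < P_ R d j -> concave_upto R N (fun k => phi d j k%:R).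
Proof.
move=> P0 [|k] _.
  rewrite (phi_natE _ _ _ _ _ 2) // (phi_natE _ _ _ _ _ 1) // ln1 /phi ltxx.
  by rewrite lnM ?posrE //; lra.
rewrite !phi_natE //.
have := ln_natD1_concave R k.+1%:R (ltr0Sn _ _).
rewrite -!natr1; lra.
Qed.

(** The penalty [delta] is large enough for the first increment of psi to
    exceed the second one, ln 2. *)
Lemma psi_concave (R : realType) (n m U : nat) (d : 'M[bool]_(n, m))
    (j : 'I_m) :
  0 < P_ R d j -> (1 <= U <= n)%N ->
  concave_upto R n (fun k => psi d U j k%:R).
Proof.
move=> P0 Un [|k] kn; last first.
  rewrite !psi_natE //.
  have := ln_natD1_concave R k.+1%:R (ltr0Sn _ _).
  by rewrite -!natr1; lra.
have /andP[U1 _] := Un; have n1 : (1 <= n)%N by apply: ltnW.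
have P1 := P_le1 R n m d j n1.
rewrite (psi_natE _ _ _ _ _ _ 2) // (psi_natE _ _ _ _ _ _ 1) // psi0E // ln1.
have := ler_ln_nat R U n Un; have := ler_ln_nat R 2 n kn.
have lnP : ln (P_ R d j) <= 0 by exact: ln_le0.
have : 2 * ln n%:R <= delta R n m / P_ R d j.
  rewrite ler_pdivlMr //.
  have : 2 * ln n%:R <= delta R n m.
    apply: le_trans (delta_ge R n m); rewrite ler_wpM2r ?ln_nat_ge0 //.
    by rewrite ler_nat ltnS; case: j {P0 P1 lnP} => j /(leq_trans _); apply.
  have := ln_nat_ge0 R n; nra.
lra.
Qed.

(** * Both objectives as functions of the selected set *)

Lemma sum_chi (R : realType) (n : nat) (S T : {set 'I_n}) :
  \sum_(i in T) chi R S 0 i = #|S :&: T|%:R.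
Proof. by rewrite setIC -sum_mem_nat; apply: eq_bigr => i _; rewrite mxE. Qed.

Lemma sum_chiT (R : realType) (n : nat) (S : {set 'I_n}) :
  \sum_i chi R S 0 i = #|S|%:R.
Proof.
by rewrite -[S in RHS]setIT -sum_chi; apply: eq_bigl => i; rewrite inE.
Qed.

Lemma f_chi (R : realType) (n m : nat) (d : 'M[bool]_(n, m)) (j : 'I_m)
    (S : {set 'I_n}) :
  f_ d j (chi R S) = phi d j #|S|%:R.
Proof. by rewrite /f_ sum_chiT. Qed.

Lemma g_chi (R : realType) (n m U : nat) (d : 'M[bool]_(n, m)) (j : 'I_m)
    (S : {set 'I_n}) :
  g_ d U j (chi R S) = psi d U j #|S :&: ones d j|%:R.
Proof.
rewrite /g_ -sum_chi [in RHS]big_mkcond; congr psi; apply: eq_bigr => i _.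
by rewrite inE; case: (d i j); rewrite ?mul1r ?mul0r.
Qed.

Lemma submodular_f (R : realType) (n m : nat) (d : 'M[bool]_(n, m))
    (j : 'I_m) : 0 < P_ R d j -> submodular R n (f_ d j).
Proof.
move=> P0; apply: (submodular_card _ _ _ [set: 'I_n]).
  exact: phi_concave P0.
by move=> T; rewrite f_chi setIT.
Qed.

Lemma submodular_g (R : realType) (n m U : nat) (d : 'M[bool]_(n, m))
    (j : 'I_m) :
  0 < P_ R d j -> (1 <= U <= n)%N -> submodular R n (g_ d U j).
Proof.
move=> P0 Un; apply: (submodular_card _ _ _ (ones d j)).
  move=> k kN; apply: (psi_concave _ _ _ _ _ _ P0 Un).
  exact: leq_trans kN (card_ones_le _ _ _ _).
by move=> T; rewrite g_chi.
Qed.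

Definition env_term (R : realType) (n m U : nat) (d : 'M[bool]_(n, m))
    (S : {set 'I_n}) (j : 'I_m) : R :=
  P_ R d j * `|f_ d j (chi R S) - g_ d U j (chi R S)|.

(** The objective of the envelope formulation once the continuous variables
    are optimal for the given set. *)
Definition env_cost (R : realType) (n m U : nat) (d : 'M[bool]_(n, m))
    (S : {set 'I_n}) : R := \sum_j env_term R n m U d S j.

Definition covers (n m : nat) (d : 'M[bool]_(n, m)) (S : {set 'I_n})
    (j : 'I_m) : bool := (0 < #|S :&: ones d j|)%N.

Lemma env_term_ge0 (R : realType) (n m U : nat) (d : 'M[bool]_(n, m))
    (S : {set 'I_n}) (j : 'I_m) :
  0 < P_ R d j -> 0 <= env_term R n m U d S j.
Proof. by move=> P0; rewrite mulr_ge0 // ltW. Qed.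

(** Here the ratio of [P_j] to the proportion within [S] lies between 1 / n
    and n. *)
Lemma env_term_covered (R : realType) (n m U : nat) (d : 'M[bool]_(n, m))
    (S : {set 'I_n}) (j : 'I_m) :
  0 < P_ R d j -> (1 <= n)%N -> covers n m d S j ->
  env_term R n m U d S j <= P_ R d j * ln n%:R.
Proof.
move=> P0 n1 cov; have Sc : (#|S :&: ones d j| <= #|S|)%N.
  by rewrite subset_leq_card ?subsetIl.
have S1 : (1 <= #|S|)%N := leq_trans cov Sc.
have Sn : (#|S| <= n)%N by rewrite -[leqRHS]card_ord max_card.
rewrite ler_pM2l // f_chi g_chi phi_natE // psi_natE // ler_norml.
have := ln_P_ge R n m d j n1 P0; have := ln_le0 (P_le1 R n m d j n1).
have := ler_ln_nat R _ _ (introT andP (conj cov Sc)).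
have := ler_ln_nat R _ _ (introT andP (conj S1 Sn)).
have := ln_nat_ge0 R #|S :&: ones d j|.
by move=> *; apply/andP; split; lra.
Qed.

Lemma env_term_uncovered (R : realType) (n m U : nat) (d : 'M[bool]_(n, m))
    (S : {set 'I_n}) (j : 'I_m) :
  0 < P_ R d j -> (1 <= #|S|)%N -> (1 <= U <= n)%N -> ~~ covers n m d S j ->
  env_term R n m U d S j
    = delta R n m - P_ R d j * (ln U%:R - ln #|S|%:R).
Proof.
move=> P0 S1 Un; rewrite /covers lt0n negbK => /eqP c0.
have /andP[U1 /(leq_trans U1) n1] := Un.
have P1 := P_le1 R n m d j n1.
rewrite /env_term f_chi g_chi c0 phi_natE // psi0E // ger0_norm.
  have := divfK (lt0r_neq0 P0) (delta R n m); nra.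
have : ln n%:R <= delta R n m / P_ R d j.
  rewrite ler_pdivlMr //.
  have := delta_ge R n m; rewrite -natr1 mulrDl mul1r.
  have := ln_nat_ge0 R n; have : 0 <= (m%:R : R) by [].
  nra.
have := ler_ln_nat R _ _ Un; have := ln_nat_ge0 R #|S|.
lra.
Qed.

(** * Comparison of the two objectives *)

Lemma PS_eq0 (R : realType) (n m : nat) (d : 'M[bool]_(n, m))
    (S : {set 'I_n}) (j : 'I_m) :
  (1 <= #|S|)%N -> (PS R d S j == 0) = ~~ covers n m d S j.
Proof.
by move=> S1; rewrite PSE mulf_eq0 invr_eq0 !pnatr_eq0 [#|S| == _]eqn0Ngt S1
  /covers lt0n negbK.
Qed.

Lemma env_term_coveredE (R : realType) (n m U : nat) (d : 'M[bool]_(n, m))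
    (S : {set 'I_n}) (j : 'I_m) :
  0 < P_ R d j -> (1 <= #|S|)%N -> covers n m d S j ->
  env_term R n m U d S j = P_ R d j * `|ln (P_ R d j / PS R d S j)|.
Proof.
move=> P0 S1 cov; rewrite /env_term f_chi g_chi phi_natE // psi_natE // PSE.
move: (P_ R d j) P0 => P P0.
have S0 : 0 < #|S|%:R :> R by rewrite ltr0n.
have c0 : 0 < #|S :&: ones d j|%:R :> R by rewrite ltr0n.
rewrite ln_div ?posrE ?mulr_gt0 ?invr_gt0 //.
rewrite lnM ?posrE ?invr_gt0 // lnV ?posrE //.
by congr (_ * `|_|); lra.
Qed.

(** For an uncovered [j] the envelope term falls short of [delta] by
    [P_j] times the logarithm of [U / #|S|]. *)
Lemma env_cost_le_rskl_obj (R : realType) (n m U : nat) (d : 'M[bool]_(n, m))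
    (S : {set 'I_n}) :
  (forall j, 0 < P_ R d j) -> (1 <= #|S| <= U)%N -> (U <= n)%N ->
  env_cost R n m U d S <= rskl_obj R d S.
Proof.
move=> hP /andP[S1 SU] Un; have U1 := leq_trans S1 SU.
apply: ler_sum => j _; rewrite PS_eq0 //; case: ifPn => cov; last first.
  by rewrite env_term_coveredE // -[covers _ _ _ _ _]negbK.
rewrite env_term_uncovered ?U1 // gerBl mulr_ge0 ?(ltW (hP j)) //.
by rewrite subr_ge0 ler_ln_nat // S1.
Qed.

Lemma env_cost_eq_rskl_obj (R : realType) (n m U : nat) (d : 'M[bool]_(n, m))
    (S : {set 'I_n}) :
  (forall j, 0 < P_ R d j) -> (1 <= #|S| <= U)%N -> (U <= n)%N ->
  (forall j, covers n m d S j) \/ #|S| = U ->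
  env_cost R n m U d S = rskl_obj R d S.
Proof.
move=> hP /andP[S1 SU] Un Sgood; have U1 := leq_trans S1 SU.
apply: eq_bigr => j _; rewrite PS_eq0 //; case: ifPn => cov; last first.
  by rewrite env_term_coveredE // -[covers _ _ _ _ _]negbK.
case: Sgood => [allcov|SU']; first by rewrite allcov in cov.
by rewrite env_term_uncovered ?U1 // SU' subrr mulr0 subr0.
Qed.

(** If [j] is covered afterwards, the new term is at most ln n; if not, only
    the size of the set enters the term, and it enters through its
    logarithm. *)
Lemma env_term_setU1_le (R : realType) (n m U : nat) (d : 'M[bool]_(n, m))
    (S : {set 'I_n}) (i : 'I_n) (j : 'I_m) :
  0 < P_ R d j -> (1 <= #|S|)%N -> (1 <= U <= n)%N -> i \notin S ->
  env_term R n m U d (i |: S) j <= env_term R n m U d S j + ln n%:R.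
Proof.
move=> P0 S1 Un iS; have n1 : (1 <= n)%N by case/andP: Un => /leq_trans; apply.
have P1 := P_le1 R n m d j n1; have lnn := ln_nat_ge0 R n.
have [cov'|cov'] := boolP (covers n m d (i |: S) j).
  have := env_term_covered R n m U d _ _ P0 n1 cov'.
  have := env_term_ge0 R n m U d S j P0; nra.
have cov : ~~ covers n m d S j.
  apply: contra cov' => /leq_trans; apply.
  by rewrite subset_leq_card // setSI // subsetUr.
have Sn : (#|i |: S| <= n)%N by rewrite -[leqRHS]card_ord max_card.
have S1' : (1 <= #|i |: S|)%N by rewrite cardsU1 iS.
rewrite !env_term_uncovered //.
have := ler_ln_nat R _ _ (introT andP (conj S1' Sn)).
have := ln_nat_ge0 R #|S|.
suff : ln #|S|%:R <= ln #|i |: S|%:R :> R by nra.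
by rewrite ler_ln_nat // S1 subset_leq_card // subsetUr.
Qed.

(** Covering [j] saves more than [m - 1] times [ln n]; the saving is strict
    because [P_j < 1] as [S] misses the whole of [ones d j]. *)
Lemma env_term_newly_covered_lt (R : realType) (n m U : nat)
    (d : 'M[bool]_(n, m)) (S S' : {set 'I_n}) (j : 'I_m) :
  0 < P_ R d j -> (1 <= #|S| < n)%N -> (1 <= U <= n)%N ->
  ~~ covers n m d S j -> covers n m d S' j ->
  env_term R n m U d S' j + m%:R * ln n%:R
    < env_term R n m U d S j + ln n%:R.
Proof.
move=> P0 /andP[S1 Sn] Un cov cov'; have n2 : (2 <= n)%N by exact: leq_trans Sn.
have lnn : 0 < ln n%:R :> R by rewrite ln_gt0 // ltr1n.
have P1 : P_ R d j < 1.
  rewrite P_E mulrC ltr_pdivrMr ?ltr0n ?(ltnW n2) // mul1r ltr_nat.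
  have : (#|S :|: ones d j| <= n)%N by rewrite -[leqRHS]card_ord max_card.
  move: cov; rewrite /covers lt0n negbK => /eqP c0.
  rewrite cardsU c0 subn0 => /(leq_trans _); apply.
  by rewrite -addn1 addnC leq_add2r.
have := env_term_covered R n m U d _ _ P0 (ltnW n2) cov'.
rewrite (env_term_uncovered R n m U d S j) //.
have := ler_ln_nat R _ _ Un; have := ln_nat_ge0 R #|S|.
have := delta_ge R n m; rewrite -natr1 mulrDl mul1r.
move: (m%:R * ln n%:R) => M; nra.
Qed.

(** If some [j] is uncovered and there is room for one more element, an
    element of [ones d j] may be added: the other [m - 1] terms rise by at
    most [ln n] each. *)
Lemma env_cost_not_minimal (R : realType) (n m U : nat) (d : 'M[bool]_(n, m))
    (S : {set 'I_n}) (j : 'I_m) :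
  (forall j, 0 < P_ R d j) -> (1 <= #|S| < U)%N -> (U <= n)%N ->
  ~~ covers n m d S j ->
  exists2 i, i \notin S & env_cost R n m U d (i |: S) < env_cost R n m U d S.
Proof.
move=> hP /andP[S1 SU] Un cov; have U1 : (1 <= U)%N := leq_trans S1 (ltnW SU).
have /set0Pn[i ij] : ones d j != set0.
  by rewrite -card_gt0 (card_ones_gt0 R n m d j (hP j)).
have iS : i \notin S.
  by apply: contra cov => iS; apply/card_gt0P; exists i; rewrite inE iS.
exists i => //.
have cov' : covers n m d (i |: S) j.
  by apply/card_gt0P; exists i; rewrite in_setI ij setU11.
have := env_term_newly_covered_lt R n m U d S (i |: S) j (hP j).
rewrite S1 U1 (leq_trans SU Un) => /(_ isT Un cov cov') lt_j.
have le_others : \sum_(l | l != j) env_term R n m U d (i |: S) l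
    <= \sum_(l | l != j) (env_term R n m U d S l + ln n%:R).
  by apply: ler_sum => l _; apply: env_term_setU1_le; rewrite ?U1.
have others : \sum_(l < m | l != j) (ln n%:R : R) = (m%:R - 1) * ln n%:R.
  rewrite sumr_const cardC1 card_ord -[LHS]mulr_natl -subn1 natrB //.
  by case: (j) => l; apply: leq_trans.
rewrite /env_cost (bigD1 j) //= [ltRHS](bigD1 j) //=.
move: le_others; rewrite big_split others /=; lra.
Qed.

Lemma optimal_value_eq (R : realType) (T : Type) (F : set T) (obj : T -> R)
    (t : T) :
  optimal_solution F obj t -> optimal_value F obj = (obj t)%:E.
Proof.
case=> Ft tmin; apply/eqP; rewrite eq_le; apply/andP; split.
  by apply: ereal_inf_lbound; exists t.
by apply: le_ereal_inf_tmp => _ [t' Ft' <-]; rewrite lee_fin tmin.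
Qed.

(** Minimizers of the envelope cost either cover every [j] or have [U]
    elements, so that both objectives agree on them. *)
Lemma env_cost_minimizer_eq (R : realType) (n m L U : nat)
    (d : 'M[bool]_(n, m)) (S : {set 'I_n}) :
  (1 <= L)%N -> (U <= n)%N -> (forall j, 0 < P_ R d j) ->
  optimal_solution (rskl_feasible L U) (env_cost R n m U d) S ->
  env_cost R n m U d S = rskl_obj R d S.
Proof.
move=> L1 Un hP [/andP[LS SU] Smin].
have S1 := leq_trans L1 LS.
apply: env_cost_eq_rskl_obj; rewrite ?S1 //.
have [SltU|US] := ltnP #|S| U; last by right; apply/eqP; rewrite eqn_leq SU.
left=> j; apply/negPn/negP => cov.
have := env_cost_not_minimal R n m U d S j hP.
rewrite S1 SltU => /(_ isT Un cov)[i iS]; apply/negP; rewrite -leNgt.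
apply: Smin; rewrite /rskl_feasible /= cardsU1 iS SltU.
by rewrite (leq_trans LS) // leq_addl.
Qed.

Lemma env_cost_minimizer_exists (R : realType) (n m L U : nat)
    (d : 'M[bool]_(n, m)) :
  (L <= U)%N -> (U <= n)%N ->
  exists S, optimal_solution (rskl_feasible L U) (env_cost R n m U d) S.
Proof.
move=> LU Un.
have S0L : (L <= #|prefix_set n 1 L| <= U)%N.
  by rewrite card_prefix_set ?leqnn // (leq_trans LU).
pose P (S : {set 'I_n}) := (L <= #|S| <= U)%N.
case: (@arg_minP _ _ _ _ P (env_cost R n m U d) S0L) => S PS Smin.
by exists S; split=> // S' /Smin.
Qed.

(** The envelope cost is a lower bound of the other objective that is attained
    at the minimizers of the envelope cost. *)
Lemma optimal_rskl_env_cost (R : realType) (n m L U : nat)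
    (d : 'M[bool]_(n, m)) (S : {set 'I_n}) :
  (1 <= L <= U)%N -> (U <= n)%N -> (forall j, 0 < P_ R d j) ->
  optimal_solution (rskl_feasible L U) (rskl_obj R d) S <->
  optimal_solution (rskl_feasible L U) (env_cost R n m U d) S.
Proof.
move=> /andP[L1 LU] Un hP.
have le_obj S' : rskl_feasible L U S' ->
    env_cost R n m U d S' <= rskl_obj R d S'.
  move=> /andP[LS' S'U]; apply: env_cost_le_rskl_obj => //.
  by rewrite (leq_trans L1 LS').
split=> [[FS Smin]|Sopt]; split; try by case: Sopt.
- by [].
- have [S0 S0opt] := env_cost_minimizer_exists R n m L U d LU Un.
  have [FS0 S0min] := S0opt.
  move=> S' FS'; apply: le_trans (S0min S' FS').
  apply: le_trans (le_obj S FS) _.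
  by rewrite (env_cost_minimizer_eq R n m L U d S0 L1 Un hP S0opt); apply: Smin.
- move=> S' FS'; rewrite -(env_cost_minimizer_eq R n m L U d S L1 Un hP Sopt).
  by apply: le_trans (le_obj S' FS'); case: Sopt => _; apply.
Qed.

(** * Feasible and optimal points of the envelope problem *)

Lemma binary_chi (R : realType) (n : nat) (x : 'rV[R]_n) :
  binary x -> exists S : {set 'I_n}, x = chi R S.
Proof.
move=> xb; exists [set i | x 0 i == 1]; apply/rowP => i; rewrite mxE inE.
by case: (xb i) => ->; rewrite ?eqxx // eq_sym oner_eq0.
Qed.

Lemma chi_binary (R : realType) (n : nat) (S : {set 'I_n}) :
  binary (chi R S).
Proof. by move=> i; rewrite mxE; case: (i \in S); [right | left]. Qed.

Lemma binary_in_unit_cube (R : realType) (n : nat) (x : 'rV[R]_n) :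
  binary x -> in_unit_cube x.
Proof. by move=> xb i; case: (xb i) => ->; rewrite ?lexx ?ler01. Qed.

(** At 0/1 vectors both envelopes of a function agree with it, so that the
    constraints force [s] and [t] to be the function values. *)
Lemma env_feasible_chi (R : realType) (n m L U : nat) (d : 'M[bool]_(n, m))
    (v : env_var R n m) (S : {set 'I_n}) :
  (forall j, 0 < P_ R d j) -> (1 <= U <= n)%N -> xpart v = chi R S ->
  env_feasible R d L U v <->
  rskl_feasible L U S /\
  forall j, [/\ spart v 0 j = f_ d j (chi R S),
                tpart v 0 j = g_ d U j (chi R S) &
                `|f_ d j (chi R S) - g_ d U j (chi R S)| <= mupart v 0 j].
Proof.
move=> hP Un vS; have n1 : (1 <= n)%N by case/andP: Un => /leq_trans; apply.
have concf j a : a <= conc_f d j (chi R S) <-> a <= f_ d j (chi R S).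
  rewrite /conc_f sum_chiT f_chi; apply: le_min_conc_piece_nat => //.
    exact: phi_concave.
  by rewrite -[leqRHS]card_ord max_card.
have concg j a : a <= conc_g d U j (chi R S) <-> a <= g_ d U j (chi R S).
  rewrite /conc_g sum_chi g_chi; apply: le_min_conc_piece_nat.
  - move=> k kN; apply: (psi_concave _ _ _ _ _ _ (hP j) Un).
    exact: leq_trans kN (card_ones_le _ _ _ _).
  - exact: card_ones_gt0 (hP j).
  - by rewrite subset_leq_card // subsetIr.
have env_eq (F C s : R) : (forall a, a <= C <-> a <= F) ->
    (F <= s <= C) <-> s = F.
  move=> CF; split=> [/andP[Fs /CF sF]|->].
    by apply/eqP; rewrite eq_le sF.
  by rewrite lexx; apply/CF.
have norm_le (a b c : R) : `|a - b| <= c <-> (a - b <= c) /\ (- a + b <= c).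
  rewrite ler_norml; split=> [/andP[]|[]] *; first by split; lra.
  by apply/andP; split; lra.
rewrite /env_feasible /= vS sum_chiT !ler_nat; split.
  case=> _ LSU hj; split=> // j; have := hj j.
  rewrite !lovasz_chi => -[le1 le2 /(env_eq _ _ _ (concf j)) sE].
  move=> /(env_eq _ _ _ (concg j)) tE; rewrite sE tE in le1 le2 *.
  by split=> //; apply/norm_le.
case=> LSU hj; split=> //; first exact: chi_binary.
move=> j; have [sE tE /norm_le[le1 le2]] := hj j.
rewrite !lovasz_chi sE tE; split=> //; first exact/(env_eq _ _ _ (concf j)).
exact/(env_eq _ _ _ (concg j)).
Qed.

Definition env_point (R : realType) (n m U : nat) (d : 'M[bool]_(n, m))
    (S : {set 'I_n}) : env_var R n m :=
  (chi R S,
   \row_j `|f_ d j (chi R S) - g_ d U j (chi R S)|,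
   \row_j f_ d j (chi R S), \row_j g_ d U j (chi R S)).

Lemma env_obj_env_point (R : realType) (n m U : nat) (d : 'M[bool]_(n, m))
    (S : {set 'I_n}) :
  env_obj R d (env_point R n m U d S) = env_cost R n m U d S.
Proof. by apply: eq_bigr => j _; rewrite /mupart /env_point /= mxE. Qed.

Lemma env_point_feasible (R : realType) (n m L U : nat) (d : 'M[bool]_(n, m))
    (S : {set 'I_n}) :
  (forall j, 0 < P_ R d j) -> (1 <= U <= n)%N -> rskl_feasible L U S ->
  env_feasible R d L U (env_point R n m U d S).
Proof.
move=> hP Un FS; apply/(env_feasible_chi _ _ _ _ _ _ _ S) => //; split=> // j.
by split; rewrite /spart /tpart /mupart /env_point /= mxE.
Qed.

Lemma env_cost_le_env_obj (R : realType) (n m L U : nat)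
    (d : 'M[bool]_(n, m)) (v : env_var R n m) (S : {set 'I_n}) :
  (forall j, 0 < P_ R d j) -> (1 <= U <= n)%N -> xpart v = chi R S ->
  env_feasible R d L U v ->
  rskl_feasible L U S /\ env_cost R n m U d S <= env_obj R d v.
Proof.
move=> hP Un vS /(env_feasible_chi _ _ _ _ _ _ _ _ hP Un vS)[FS hj].
split=> //; apply: ler_sum => j _; rewrite ler_pM2l //.
by have [] := hj j.
Qed.

Lemma optimal_env_point (R : realType) (n m L U : nat) (d : 'M[bool]_(n, m))
    (S : {set 'I_n}) :
  (forall j, 0 < P_ R d j) -> (1 <= U <= n)%N ->
  optimal_solution (rskl_feasible L U) (env_cost R n m U d) S ->
  optimal_solution (env_feasible R d L U) (env_obj R d)
    (env_point R n m U d S).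
Proof.
move=> hP Un [FS Smin]; split; first exact: env_point_feasible.
move=> v Fv; have [vb _ _] := Fv.
have [T vT] := binary_chi R n (xpart v) vb.
have [FT le_v] := env_cost_le_env_obj _ _ _ _ _ _ _ _ hP Un vT Fv.
by rewrite env_obj_env_point; apply: le_trans le_v; apply: Smin.
Qed.

Lemma optimal_env_xpart (R : realType) (n m L U : nat) (d : 'M[bool]_(n, m))
    (v : env_var R n m) (S : {set 'I_n}) :
  (forall j, 0 < P_ R d j) -> (1 <= U <= n)%N -> xpart v = chi R S ->
  optimal_solution (env_feasible R d L U) (env_obj R d) v ->
  optimal_solution (rskl_feasible L U) (env_cost R n m U d) S.
Proof.
move=> hP Un vS [Fv vmin].
have [FS le_v] := env_cost_le_env_obj _ _ _ _ _ _ _ _ hP Un vS Fv.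
split=> // T FT; rewrite -(env_obj_env_point R n m U d T).
by apply: le_trans le_v _; apply: vmin; apply: env_point_feasible.
Qed.

(** * The envelope formulation as a mixed-integer linear program *)

Section Affine.
Context {R : realType} {V : lmodType R}.
Implicit Types (h : V -> R) (v : V).

Lemma affine_scalar h : scalar h -> affine h.
Proof. by move=> hl; exists h, 0; split=> // v; rewrite addr0. Qed.

Lemma affine_cst (c : R) : affine (fun _ : V => c).
Proof.
exists (fun=> 0), c; split=> [a u v|v]; first by rewrite mulr0 addr0.
by rewrite add0r.
Qed.

Lemma affineD h1 h2 : affine h1 -> affine h2 -> affine (fun v => h1 v + h2 v).
Proof.
move=> [l1 [c1 [l1l h1E]]] [l2 [c2 [l2l h2E]]].
exists (fun v => l1 v + l2 v), (c1 + c2); split=> [a u v|v].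
  by rewrite l1l l2l; lra.
by rewrite h1E h2E addrACA.
Qed.

Lemma affineZ (b : R) h : affine h -> affine (fun v => b * h v).
Proof.
move=> [l [c [ll hE]]]; exists (fun v => b * l v), (b * c).
split=> [a u v|v]; first by rewrite ll; lra.
by rewrite hE mulrDr.
Qed.

Lemma affineN h : affine h -> affine (fun v => - h v).
Proof.
move=> /(affineZ (-1))[l [c [ll hE]]]; exists l, c; split=> // v.
by rewrite -hE mulN1r.
Qed.

Lemma affine_sum (I : Type) (r : seq I) (P : pred I) (F : I -> V -> R) :
  (forall i, affine (F i)) -> affine (fun v => \sum_(i <- r | P i) F i v).
Proof.
move=> FA; elim: r => [|i r IHr].
  have -> : (fun v => \sum_(j <- [::] | P j) F j v) = (fun=> 0).
    by apply/funext => v; rewrite big_nil.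
  exact: affine_cst.
have -> : (fun v => \sum_(j <- i :: r | P j) F j v)
    = (fun v => (if P i then 1 else 0) * F i v + \sum_(j <- r | P j) F j v).
  apply/funext => v; rewrite big_cons.
  by case: (P i); rewrite ?mul1r ?mul0r ?add0r.
by apply: affineD => //; apply: affineZ.
Qed.

Lemma affine_conc_piece (h : R -> R) (k : nat) (z : V -> R) :
  affine z -> affine (fun v => conc_piece h k (z v)).
Proof.
move=> za; rewrite /conc_piece; apply: affineD; last exact: affine_cst.
by apply: affineD; [apply: affineZ | apply: affine_cst].
Qed.

Lemma affine_perm_form (n : nat) (f : 'rV[R]_n -> R) (p : {perm 'I_n})
    (x : V -> 'rV[R]_n) :
  (forall i, affine (fun v => x v 0 i)) ->
  affine (fun v => perm_form f p (x v)).
Proof.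
move=> xa; rewrite /perm_form; apply: affineD; last exact: affine_cst.
by apply: affine_sum => i; apply: affineZ.
Qed.

End Affine.

Lemma Forall_cat (T : Type) (P : T -> Prop) (s1 s2 : seq T) :
  List.Forall P (s1 ++ s2) <-> List.Forall P s1 /\ List.Forall P s2.
Proof. exact: List.Forall_app. Qed.

Lemma Forall_map (A : eqType) (T : Type) (P : T -> Prop) (F : A -> T)
    (s : seq A) :
  List.Forall P [seq F x | x <- s] <-> {in s, forall x, P (F x)}.
Proof.
elim: s => [|x s IHs] /=; first by split=> // _; apply: List.Forall_nil.
rewrite List.Forall_cons_iff IHs; split=> [[Px Ps] y|Ps].
  by rewrite inE => /orP[/eqP ->|/Ps].
split=> [|y ys]; first by apply: Ps; rewrite mem_head.
by apply: Ps; rewrite inE ys orbT.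
Qed.

Lemma Forall_flatten_map (A : eqType) (T : Type) (P : T -> Prop)
    (F : A -> seq T) (s : seq A) :
  List.Forall P (flatten [seq F x | x <- s]) <->
  {in s, forall x, List.Forall P (F x)}.
Proof.
elim: s => [|x s IHs] /=; first by split=> // _; apply: List.Forall_nil.
rewrite Forall_cat IHs; split=> [[Px Ps] y|Ps].
  by rewrite inE => /orP[/eqP ->|/Ps].
split=> [|y ys]; first by apply: Ps; rewrite mem_head.
by apply: Ps; rewrite inE ys orbT.
Qed.

(** The finite system is unfolded once, so that its affinity and its
    satisfaction can both be read off constraint by constraint. *)
Lemma Forall_env_system (R : realType) (n m L U : nat) (d : 'M[bool]_(n, m))
    (P : (env_var R n m -> R) * (env_var R n m -> R) -> Prop) :
  List.Forall P (env_system R d L U) <->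
  [/\ P (fun=> L%:R, fun v => \sum_i xpart v 0 i),
      P (fun v => \sum_i xpart v 0 i, fun=> U%:R) &
      forall j,
        [/\ P (fun v => spart v 0 j - tpart v 0 j, fun v => mupart v 0 j) /\
            P (fun v => - spart v 0 j + tpart v 0 j, fun v => mupart v 0 j),
            forall p : {perm 'I_n},
              P (fun v => perm_form (f_ d j) p (xpart v), fun v => spart v 0 j),
            forall p : {perm 'I_n},
              P (fun v => perm_form (g_ d U j) p (xpart v),
                 fun v => tpart v 0 j),
            forall k, (1 <= k <= n)%N ->
              P (fun v => spart v 0 j,
                 fun v => conc_piece (phi d j) k (\sum_i xpart v 0 i)) &
            forall k, (1 <= k <= #|ones d j|)%N ->
              P (fun v => tpart v 0 j,
                 fun v => conc_piece (psi d U j) k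
                            (\sum_(i in ones d j) xpart v 0 i))]].
Proof.
rewrite /env_system /image_mem Forall_cat Forall_flatten_map.
rewrite !List.Forall_cons_iff; split.
  case=> -[PL [PU _]] Pj; split=> // j.
  have := Pj j (mem_enum _ _).
  rewrite !Forall_cat !Forall_map !List.Forall_cons_iff.
  case=> -[P1 [P2 _]] [Pf [Pg [Pcf Pcg]]]; split=> // [p|p|k kN|k kN].
  - by apply: Pf; rewrite mem_enum.
  - by apply: Pg; rewrite mem_enum.
  - by apply: Pcf; rewrite mem_iota add1n ltnS.
  - by apply: Pcg; rewrite mem_iota add1n ltnS.
case=> PL PU Pj; split; first by split=> //; split.
move=> j _; have [[P1 P2] Pf Pg Pcf Pcg] := Pj j.
rewrite !Forall_cat !Forall_map !List.Forall_cons_iff.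
split; first by split=> //; split.
split; first by move=> p _; apply: Pf.
split; first by move=> p _; apply: Pg.
by split=> k; rewrite mem_iota add1n ltnS; [apply: Pcf | apply: Pcg].
Qed.

(** All the functions of the formulation are built from coordinates of the
    variable by linear combinations and constants. *)
Lemma env_is_milp (R : realType) (n m L U : nat) (d : 'M[bool]_(n, m)) :
  (forall j, 0 < P_ R d j) -> (1 <= U <= n)%N ->
  is_milp (env_binary R n m) (env_feasible R d L U) (env_obj R d)
    (env_system R d L U).
Proof.
move=> hP Un; have n1 : (1 <= n)%N by case/andP: Un => /leq_trans; apply.
have xa i : affine (fun v : env_var R n m => xpart v 0 i).
  by apply: affine_scalar => a u v; rewrite /xpart !mxE.
have ma j : affine (fun v : env_var R n m => mupart v 0 j).
  by apply: affine_scalar => a u v; rewrite /mupart !mxE.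
have sa j : affine (fun v : env_var R n m => spart v 0 j).
  by apply: affine_scalar => a u v; rewrite /spart !mxE.
have ta j : affine (fun v : env_var R n m => tpart v 0 j).
  by apply: affine_scalar => a u v; rewrite /tpart !mxE.
have suma (Q : pred 'I_n) :
    affine (fun v : env_var R n m => \sum_(i | Q i) xpart v 0 i).
  exact: affine_sum.
split.
- move=> a u v; rewrite /env_obj mulr_sumr -big_split; apply: eq_bigr => j _.
  by rewrite /mupart !mxE /= mulrDr mulrCA.
- apply/Forall_env_system; split=> [||j].
  + by split; [apply: affine_cst | apply: suma].
  + by split; [apply: suma | apply: affine_cst].
  split=> [|p|p|k _|k _].
  + split; split; try exact: ma.
      by apply: affineD; [apply: sa | apply: affineN; apply: ta].
    by apply: affineD; [apply: affineN; apply: sa | apply: ta].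
  + by split; [apply: affine_perm_form | apply: sa].
  + by split; [apply: affine_perm_form | apply: ta].
  + by split; [apply: sa | apply: affine_conc_piece; apply: suma].
  + by split; [apply: ta | apply: affine_conc_piece; apply: suma].
apply/seteqP; split=> v /=; rewrite /satisfies.
  case=> vb /andP[Lv vU] hj; split=> //; apply/Forall_env_system; split=> // j.
  have x01 := binary_in_unit_cube _ _ _ vb.
  have [le1 le2 /andP[fs sc] /andP[gt tc]] := hj j; split=> //=.
  - by move/(lovasz_le _ _ _ _ _ (submodular_f _ _ _ _ _ (hP j)) x01): fs.
  - by move/(lovasz_le _ _ _ _ _ (submodular_g _ _ _ _ _ _ (hP j) Un) x01): gt.
  - by move/le_min_upto: sc; apply.
  - by move/le_min_upto: tc; apply; apply: card_ones_gt0 (hP j).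
case=> vb /Forall_env_system[/= Lv vU hj]; split=> //; first by rewrite Lv.
have x01 := binary_in_unit_cube _ _ _ vb.
move=> j; have [[le1 le2] fs gt sc tc] := hj j; split=> //.
  apply/andP; split; last exact/le_min_upto.
  exact/(lovasz_le _ _ _ _ _ (submodular_f _ _ _ _ _ (hP j)) x01).
apply/andP; split; last by apply/le_min_upto => //; apply: card_ones_gt0 (hP j).
exact/(lovasz_le _ _ _ _ _ (submodular_g _ _ _ _ _ _ (hP j) Un) x01).
Qed.

Theorem theorem2 (R : realType) (n m L U : nat) (d : 'M[bool]_(n, m))
    (hn : (1 <= n)%N) (hm : (1 <= m)%N)
    (hL : (1 <= L)%N) (hLU : (L <= U)%N) (hU : (U <= n)%N)
    (hP : forall j : 'I_m, 0 < P_ R d j) :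
  [/\ (* the Lovasz and min-type constraints are finite linear systems *)
      forall (j : 'I_m) (x : 'rV[R]_n) (a : R), in_unit_cube x ->
        [/\ lovasz (f_ d j) x <= a <->
              (forall p : {perm 'I_n}, perm_form (f_ d j) p x <= a),
            lovasz (g_ d U j) x <= a <->
              (forall p : {perm 'I_n}, perm_form (g_ d U j) p x <= a),
            a <= conc_f d j x <->
              (forall k : nat, (1 <= k <= n)%N ->
                 a <= conc_piece (phi d j) k (\sum_i x 0 i)) &
            a <= conc_g d U j x <->
              (forall k : nat, (1 <= k <= #|ones d j|)%N ->
                 a <= conc_piece (psi d U j) k (\sum_(i in ones d j) x 0 i))],
      (* the envelope problem is a mixed-integer linear program *)
      is_milp (env_binary R n m) (env_feasible R d L U) (env_obj R d)
        (env_system R d L U),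
      (* same optimal value *)
      optimal_value (rskl_feasible L U) (rskl_obj R d)
        = optimal_value (env_feasible R d L U) (env_obj R d) &
      (* same optimal solutions *)
      forall S : {set 'I_n},
        optimal_solution (rskl_feasible L U) (rskl_obj R d) S <->
        exists v : env_var R n m,
          optimal_solution (env_feasible R d L U) (env_obj R d) v
          /\ xpart v = chi R S].
Proof.
have LU1 : (1 <= L <= U)%N by rewrite hL.
have Un : (1 <= U <= n)%N by rewrite (leq_trans hL hLU).
split.
- move=> j x a x01; split.
  + by apply: lovasz_le => //; apply: submodular_f.
  + by apply: lovasz_le => //; apply: submodular_g.
  + exact: le_min_upto.
  + by apply: le_min_upto; apply: card_ones_gt0 (hP j).
- exact: env_is_milp.
- have [S Sopt] := env_cost_minimizer_exists R n m L U d hLU hU.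
  rewrite (optimal_value_eq _ _ _ _ (env_point R n m U d S)); last first.
    exact: optimal_env_point.
  rewrite env_obj_env_point.
  rewrite (env_cost_minimizer_eq R n m L U d S hL hU hP Sopt).
  by apply: optimal_value_eq; apply/optimal_rskl_env_cost.
- move=> S; rewrite optimal_rskl_env_cost //; split=> [Sopt|[v [vopt vS]]].
    by exists (env_point R n m U d S); split; first exact: optimal_env_point.
  exact: optimal_env_xpart vS vopt.
Qed.
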